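(* Every weakly semi-metrizable space $X$ is first countable and has a $G_\delta$-diagonal.
   Context: All topological spaces are assumed $T_1$, and $\mathbb N=\{1,2,3,\dots\}$. A space $X$ has a $G_\delta$-diagonal if $\Delta=\{(x,x)\mid x\in X\}$ is a $G_\delta$-set in $X\times X$; equivalently, there is a sequence of open covers $(\mathcal G_n)_n$ of $X$ with $\bigcap_n St(x,\mathcal G_n)=\{x\}$ for every $x\in X$, where $St(x,\mathcal G_n)=\bigcup\{G\in\mathcal G_n\mid x\in G\}$. A distance function on a nonempty set $X$ is a function $d:X\times X\to[0,\infty)$ with $d(x,y)=0\iff x=y$ and $d(x,y)=d(y,x)$ for all $x,y$ (no triangle inequality). Put $B(x,\varepsilon)=\{y\in X\mid d(x,y)<\varepsilon\}$. A family $\mathcal V=\{V_n^x\mid x\in X,n\in\mathbb N\}$ of subsets of $X$ is adapted to $d$ if $x\in\bigcap_{k=1}^nV_k^x\subset B(x,2^{-n})$ for all $x\in X$, $n\in\mathbb N$. In this case $\mathcal T_{d,\mathcal V}$ is the topology on $X$ in which $U$ is open iff for every $x\in U$ there is $n\in\mathbb N$ with $\bigcap_{k=1}^nV_k^x\subset U$; the triple $(X,d,\mathcal V)$, equipped with this topology, is called a weakly symmetric space. In a weakly symmetric space $(X,d,\mathcal V)$, a sequence $(x_n)_n$ is $\mathcal V$-converging to $x$, written $x_n\overset{\mathcal V}{\longrightarrow}x$, if for each $m\in\mathbb N$ the set $\{x_n\mid n\in\mathbb N\}\setminus\bigcap_{k=1}^mV_k^x$ is finite. A sequence is injective if its terms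 are pairwise distinct. For $A\subset X$, $C_{\mathcal V}(A)=A\cup\{x\in X\mid$ there is an injective sequence $(x_n)_n$ in $A$ with $x_n\overset{\mathcal V}{\longrightarrow}x\}$. A weakly symmetric space $(X,d,\mathcal V)$ is weakly semi-metric if $\overline A=C_{\mathcal V}(A)$ for every $A\subset X$ (closure in $\mathcal T_{d,\mathcal V}$) and the following holds: for every sequence $(x_n)_{n\in\mathbb N}$ in $X$ and every $x\in X$ with $x\in\bigcap_nV_n^{x_n}$, one has $\bigcap_nV_n^{x_n}=\{x\}$, and if moreover $x_n\in\bigcap_{k=1}^nV_k^{x_k}$ for every $n$, then $(x_n)_n$ converges to $x$. A topological space is weakly semi-metrizable if its topology equals $\mathcal T_{d,\mathcal V}$ for some weakly semi-metric space $(X,d,\mathcal V)$. *)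

(* Defs.v *)
From HB Require Import structures.
From mathcomp Require Import all_boot all_order all_algebra.
From mathcomp Require Import all_classical all_reals topology borel_hierarchy.

Set Implicit Arguments.
Unset Strict Implicit.
Unset Printing Implicit Defensive.

Import Order.TTheory GRing.Theory Num.Theory.

Local Open Scope classical_set_scope.
Local Open Scope ring_scope.

(* Indexing: families and sequences indexed by {1, 2, 3, ...} are functions on
   nat shifted by one, so [V x n] is V_{n+1}^x and [u n] is the (n+1)-st term
   of the sequence; in particular [capV V x n] is the intersection of
   V_1^x, ..., V_{n+1}^x. *)

Section WeaklySymmetric.
Context {R : realType} {X : choiceType}.
Implicit Types (d : X -> X -> R) (V : X -> nat -> set X).

Definition distance_function d :=
  [/\ [set: X] !=set0,
      forall x y, 0 <= d x y,
      forall x y, d x y = 0 <-> x = y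
    & forall x y, d x y = d y x].

Definition dball d (x : X) (e : R) : set X := [set y | d x y < e].

Definition capV V (x : X) (n : nat) : set X := \bigcap_(k < n.+1) V x k.

Definition adapted d V :=
  forall x n, capV V x n x /\ capV V x n `<=` dball d x (2 ^- n.+1).

Definition open_dV V (U : set X) :=
  forall x, U x -> exists n, capV V x n `<=` U.

Lemma capV_le V x m n : (m <= n)%N -> capV V x n `<=` capV V x m.
Proof. by move=> mn y Vy k /= km; apply: Vy => /=; exact: leq_trans km _. Qed.

Lemma open_dVT V : open_dV V setT.
Proof. by move=> x _; exists 0%N. Qed.

Lemma open_dVI V : setI_closed (open_dV V).
Proof.
move=> A B oA oB x [/oA[m mA] /oB[n nB]]; exists (maxn m n) => y Vy; split.
- by apply: mA; apply: capV_le Vy; exact: leq_maxl.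
- by apply: nB; apply: capV_le Vy; exact: leq_maxr.
Qed.

Lemma open_dV_bigU V (I : Type) (f : I -> set X) :
  (forall i, open_dV V (f i)) -> open_dV V (\bigcup_i f i).
Proof.
move=> of_ x [i _ /of_[n nf]]; exists n.
by apply: subset_trans nf _; exact: bigcup_sup.
Qed.

(* The set X equipped with the topology T_{d,V}, which as a family of sets
   depends on V only. *)
Definition dV_space d V : Type := X.

HB.instance Definition _ d V := Choice.on (dV_space d V).
HB.instance Definition _ d V :=
  isOpenTopological.Build (dV_space d V)
    (@open_dVT V) (@open_dVI V) (@open_dV_bigU V).

Definition weakly_symmetric d V := distance_function d /\ adapted d V.

Definition V_converges V (u : nat -> X) (x : X) :=
  forall m, finite_set (range u `\` capV V x m).

Definition C_V V (A : set X) : set X :=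
  A `|` [set x | exists u : nat -> X,
                   [/\ injective u, forall n, A (u n) & V_converges V u x]].

Definition weakly_semi_metric d V :=
  [/\ weakly_symmetric d V,
      forall A : set (dV_space d V), closure A = C_V V A
    & forall (u : nat -> dV_space d V) (x : dV_space d V),
        (\bigcap_n V (u n) n) x ->
        \bigcap_n V (u n) n = [set x] /\
        ((forall n, (\bigcap_(k < n.+1) V (u k) k) (u n)) ->
         u @ \oo --> x)].

End WeaklySymmetric.

Definition weakly_semi_metrizable (R : realType) (X : topologicalType) :=
  exists (d : X -> X -> R) (V : X -> nat -> set X),
    weakly_semi_metric d V /\
    forall U : set X, open U <-> @open (dV_space d V) U.

Definition first_countable (X : topologicalType) :=
  forall x : X, exists B : set (set X),
    [/\ countable B, B `<=` nbhs x
      & forall U, nbhs x U -> exists2 W, B W & W `<=` U].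

Definition has_Gdelta_diagonal (X : topologicalType) :=
  Gdelta (diagonal : set (X * X)%type).

(* Main.v *)
Require Import Defs.
From mathcomp Require Import all_boot all_order all_algebra.
From mathcomp Require Import all_classical all_reals topology.
From mathcomp Require Import borel_hierarchy.

(* An injective sequence outside the intersection of V_1^x, ..., V_n^x cannot
   V-converge to x, so by the closure hypothesis these intersections are
   neighbourhoods of x; they form a countable base at x.  The sets G_n, union
   over x of the squares of the interiors of V_n^x, are then open and contain
   the diagonal. If (y, z) lies in all of them, there are x_n with y and z in
   every V_n^{x_n}, and the intersection of the V_n^{x_n} is a singleton. *)

Local Open Scope classical_set_scope.

Lemma nbhs_dV {R : realType} {X : choiceType} (d : X -> X -> R)
    (V : X -> nat -> set X) (x : dV_space d V) (U : set (dV_space d V)) :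
  (forall A : set (dV_space d V), closure A = C_V V A) ->
  weakly_symmetric d V ->
  nbhs x U <-> exists n, capV V x n `<=` U.
Proof.
move=> clE [_ adV]; split.
  rewrite nbhsE => -[W [oW Wx] WU].
  by have [n nW] := oW x Wx; exists n; exact: subset_trans nW WU.
move=> [n nU]; apply: (filterS nU).
have : ~ closure (~` (capV V x n : set (dV_space d V))) x.
  rewrite clE => -[/(_ (adV x n).1)//|[u [uI uV /(_ n)]]].
  have -> : range u `\` capV V x n = range u.
    by apply/seteqP; split=> [y []//|_ [k _ <-]]; split; [exists k | exact: uV].
  by rewrite (eq_finite_set (inj_card_eq (in2W uI))); exact: infinite_nat.
by rewrite closure_setC; exact: contrapT.
Qed.

Theorem proposition3p6 (R : realType) (X : topologicalType) :
  accessible_space X -> weakly_semi_metrizable R X ->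
  first_countable X /\ has_Gdelta_diagonal X.
Proof.
move=> _ [d [V [[wsV clE limV] openXV]]].
(* [X] and [dV_space d V] have the same open sets, hence the same neighbourhoods. *)
have nbhsV (x : X) (U : set X) : nbhs x U <-> exists n, capV V x n `<=` U.
  rewrite -(@nbhs_dV R X d V x U clE wsV) !nbhsE.
  by split=> -[W [oW Wx] WU]; exists W => //; split=> //; apply/openXV.
have nbhs_capV x n : nbhs x (capV V x n) by apply/nbhsV; exists n.
split.
  move=> x; exists (range (capV V x)); split.
  - exact: card_image_le.
  - by move=> _ [n _ <-].
  - by move=> U /nbhsV[n nU]; exists (capV V x n).
exists (fun n => \bigcup_x ((V x n)° `*` (V x n)°)).
  move=> n; apply: bigcup_open => x _; rewrite openE => p [p1 p2].
  by exists ((V x n)°, (V x n)°) => //; split; apply: open_nbhs_nbhs;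
    split=> //; exact: open_interior.
apply/seteqP; split=> [[x _] /diagonalP <- n _|[y z] yz].
  exists x => //.
  have Vx : (V x n)° x.
    by apply: filterS (nbhs_capV x n); apply: (@bigcap_inf _ _ n) => /=.
  by split.
have {yz} /choice[u uP] : forall n, exists x, V x n y /\ V x n z.
  by move=> n; have [x _ [/= /interior_subset ? /interior_subset]] := yz n I;
    exists x.
(* With [y] as the common point, the intersection is [[set y]]; it also contains [z], so [z = y]. *)
have [capE _] := limV u y (fun n _ => (uP n).1).
have : (\bigcap_n V (u n) n) z by move=> n _; exact: (uP n).2.
by rewrite capE => /esym.
Qed.
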